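(* Let $X$, $Y$ be two Banach spaces and $T,S\in B(X,Y)$. (1) If the linear pencil $\lambda\mapsto T-\lambda S$ has an analytic generalized resolvent on a neighborhood of $0$, then for any generalized inverse $T^+$ of $T$ there exists a neighborhood $U(0)$ of $0$ such that $$R(T-\lambda S)\cap N(T^+)=\{0\},\qquad \forall\,\lambda\in U(0).$$ (2) If $T$ has a generalized inverse $T^+$ and there exists a neighborhood $U$ of $0$ such that $$R(T-\lambda S)\cap N(T^+)=\{0\},\qquad \forall\,\lambda\in U,$$ then the linear pencil $\lambda\mapsto T-\lambda S$ has an analytic generalized resolvent on a neighborhood of $0$. In fact, $$G(\lambda)=T^+(I-\lambda ST^+)^{-1}:\ Y\to X$$ is a generalized resolvent of $\lambda\mapsto T-\lambda S$ on a neighborhood of $0$.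
   Context: All spaces are complex. $B(X,Y)$ is the Banach space of bounded linear operators from $X$ to $Y$; $N(\cdot)$ and $R(\cdot)$ denote null space and range; $I$ is the identity operator. A generalized inverse of $T\in B(X,Y)$ is an operator $T^+\in B(Y,X)$ with $TT^+T=T$ and $T^+TT^+=T^+$. For an open set $U\subset\mathbb{C}$, a function $U\ni\lambda\mapsto G(\lambda)\in B(Y,X)$ is a generalized resolvent on $U$ of the linear pencil $\lambda\mapsto T-\lambda S$ if: (i) $(T-\lambda S)G(\lambda)(T-\lambda S)=T-\lambda S$ for all $\lambda\in U$; (ii) $G(\lambda)(T-\lambda S)G(\lambda)=G(\lambda)$ for all $\lambda\in U$; (iii) $G(\lambda)-G(\mu)=(\lambda-\mu)G(\lambda)SG(\mu)$ for all $\lambda,\mu\in U$. It is an analytic generalized resolvent if moreover $\lambda\mapsto G(\lambda)$ is analytic on $U$. Neighborhoods of $0$ are open subsets of $\mathbb{C}$ containing $0$. *)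

(* Defs.v *)
From Stdlib Require Import Reals Lra FunctionalExtensionality ProofIrrelevance.
From Coquelicot Require Import Coquelicot.
Open Scope R_scope.

(** [B(X, Y)]: Coquelicot's [is_linear] includes the boundedness of the map. *)
Record bounded_op (X Y : NormedModule C_AbsRing) : Type := Bounded_op
  { op_fun :> X -> Y ; op_is_linear : is_linear op_fun }.

Arguments Bounded_op {X Y} _ _.
Arguments op_fun {X Y} _ _.
Arguments op_is_linear {X Y} _.

Section BoundedOp.

Context {X Y : NormedModule C_AbsRing}.
Implicit Types f g h : bounded_op X Y.

Lemma bounded_op_eq f g : (forall x, f x = g x) -> f = g.
Proof.
  destruct f as [f Hf], g as [g Hg]; simpl; intros E.
  assert (E' : f = g) by now apply functional_extensionality.
  subst g; f_equal; apply proof_irrelevance.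
Qed.

Lemma is_linear_scal_fun (k : C) f : is_linear (fun x => scal k (f x)).
Proof.
  apply (@is_linear_comp C_AbsRing X Y Y f (fun y => scal k y)).
  - apply op_is_linear.
  - apply (@is_linear_scal_r C_AbsRing Y k Cmult_comm).
Qed.

Lemma is_linear_plus_fun f g : is_linear (fun x => plus (f x) (g x)).
Proof.
  destruct (op_is_linear f) as [fp fs [M [M0 HM]]].
  destruct (op_is_linear g) as [gp gs [N [N0 HN]]].
  split.
  - intros x y; rewrite fp, gp, <- !plus_assoc; f_equal.
    rewrite !plus_assoc; f_equal; apply plus_comm.
  - intros k x; rewrite fs, gs; symmetry;
    apply (@scal_distr_l _ (NormedModule.ModuleSpace C_AbsRing Y)).
  - exists (M + N); split; [lra|]; intros x.
    eapply Rle_trans; [apply norm_triangle|].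
    rewrite Rmult_plus_distr_r; now apply Rplus_le_compat.
Qed.

Definition op_zero : bounded_op X Y := Bounded_op (fun _ => zero) is_linear_zero.
Definition op_plus f g : bounded_op X Y := Bounded_op _ (is_linear_plus_fun f g).
Definition op_scal (k : C) f : bounded_op X Y :=
  Bounded_op _ (is_linear_scal_fun k f).
Definition op_opp f : bounded_op X Y :=
  Bounded_op (fun x => opp (f x))
    (is_linear_comp f opp (op_is_linear f) is_linear_opp).

Definition bounded_op_AbelianMonoid_mixin :
  AbelianMonoid.mixin_of (bounded_op X Y).
Proof.
  apply (AbelianMonoid.Mixin _ op_plus op_zero);
    intros; apply bounded_op_eq; intros; simpl.
  - apply plus_comm.
  - apply plus_assoc.
  - apply plus_zero_r.
Defined.

Canonical bounded_op_AbelianMonoid :=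
  AbelianMonoid.Pack (bounded_op X Y) bounded_op_AbelianMonoid_mixin
    (bounded_op X Y).

Definition bounded_op_AbelianGroup_mixin :
  AbelianGroup.mixin_of bounded_op_AbelianMonoid.
Proof.
  apply (AbelianGroup.Mixin bounded_op_AbelianMonoid op_opp).
  intros f; apply bounded_op_eq; intros x; exact (plus_opp_r (f x)).
Defined.

Canonical bounded_op_AbelianGroup :=
  AbelianGroup.Pack (bounded_op X Y)
    (AbelianGroup.Class _ _ bounded_op_AbelianGroup_mixin) (bounded_op X Y).

Definition bounded_op_ModuleSpace_mixin :
  ModuleSpace.mixin_of C_Ring bounded_op_AbelianGroup.
Proof.
  apply (ModuleSpace.Mixin C_Ring bounded_op_AbelianGroup op_scal);
    intros; apply bounded_op_eq; intros; simpl.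
  - apply (@scal_assoc _ (NormedModule.ModuleSpace C_AbsRing Y)).
  - apply (@scal_one _ (NormedModule.ModuleSpace C_AbsRing Y)).
  - apply (@scal_distr_l _ (NormedModule.ModuleSpace C_AbsRing Y)).
  - apply (@scal_distr_r _ (NormedModule.ModuleSpace C_AbsRing Y)).
Defined.

Canonical bounded_op_ModuleSpace :=
  ModuleSpace.Pack C_Ring (bounded_op X Y)
    (ModuleSpace.Class _ _ _ bounded_op_ModuleSpace_mixin) (bounded_op X Y).

(** The infimum is taken over non-negative bounds so that the norm is [0], and
    not [m_infty], when [X] is trivial. *)
Definition op_bound f (M : R) : Prop :=
  0 <= M /\ forall x, norm (f x) <= M * norm x.

Definition op_norm f : R := real (Glb_Rbar (op_bound f)).

Lemma op_norm_glb f : is_glb_Rbar (op_bound f) (op_norm f).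
Proof.
  unfold op_norm, Glb_Rbar; destruct (ex_glb_Rbar (op_bound f)) as [l [Hl Hg]].
  simpl; split; [intros M HM|intros b Hb].
  - destruct l as [l| |]; simpl.
    + exact (Hl M HM).
    + destruct (Hl M HM).
    + apply HM.
  - generalize (Hg b Hb); destruct l as [l| |]; trivial; intros _.
    + destruct (linear_norm _ (op_is_linear f)) as [M [M0 HM]].
      destruct (Hl M (conj (Rlt_le _ _ M0) HM)).
    + assert (Z : Rbar_le 0 m_infty).
      { apply Hg; intros M HM; apply HM. }
      destruct Z.
Qed.

Lemma op_norm_ge0 f : 0 <= op_norm f.
Proof.
  apply (proj2 (op_norm_glb f) (Finite 0)); intros M HM; apply HM.
Qed.

Lemma op_norm_le f M :
  0 <= M -> (forall x, norm (f x) <= M * norm x) -> op_norm f <= M.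
Proof. intros M0 HM; apply (proj1 (op_norm_glb f) M); now split. Qed.

Lemma op_norm_apply f x : norm (f x) <= op_norm f * norm x.
Proof.
  destruct (norm_ge_0 x) as [Hx|Hx].
  - apply Rle_div_l; [exact Hx|].
    apply (proj2 (op_norm_glb f) (Finite (norm (f x) / norm x))).
    intros M [_ HM]; simpl; apply Rle_div_l; [exact Hx|apply HM].
  - destruct (linear_norm _ (op_is_linear f)) as [M [_ HM]].
    generalize (HM x); rewrite <- Hx; lra.
Qed.

Lemma op_norm_triangle f g : op_norm (plus f g) <= op_norm f + op_norm g.
Proof.
  apply op_norm_le.
  - generalize (op_norm_ge0 f) (op_norm_ge0 g); lra.
  - intros x; eapply Rle_trans; [apply norm_triangle|].
    rewrite Rmult_plus_distr_r; apply Rplus_le_compat; apply op_norm_apply.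
Qed.

Lemma op_norm_scal (k : C) f : op_norm (scal k f) <= Cmod k * op_norm f.
Proof.
  apply op_norm_le.
  - apply Rmult_le_pos; [apply Cmod_ge_0|apply op_norm_ge0].
  - intros x; eapply Rle_trans; [apply (norm_scal (V := Y))|].
    rewrite Rmult_assoc; apply Rmult_le_compat_l; [apply Cmod_ge_0|].
    apply op_norm_apply.
Qed.

Lemma op_norm_eq0 f : op_norm f = 0 -> f = zero.
Proof.
  intros H; apply bounded_op_eq; intros x; apply norm_eq_zero.
  generalize (op_norm_apply f x) (norm_ge_0 (f x)); rewrite H; lra.
Qed.

Lemma op_norm_zero : op_norm zero = 0.
Proof.
  apply Rle_antisym; [|apply op_norm_ge0].
  apply op_norm_le; [lra|]; intros x; simpl.
  change (norm (zero : Y) <= 0 * norm x); rewrite norm_zero; lra.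
Qed.

Definition op_ball f (e : R) g : Prop := op_norm (minus g f) < e.

Definition bounded_op_UniformSpace_mixin :
  UniformSpace.mixin_of (bounded_op X Y).
Proof.
  apply (UniformSpace.Mixin _ zero op_ball); unfold op_ball.
  - intros f e; rewrite minus_eq_zero.
    apply Rle_lt_trans with 0; [right; exact op_norm_zero|apply e].
  - intros f g e H; eapply Rle_lt_trans; [|exact H].
    replace (minus f g) with (scal (opp one : C_Ring) (minus g f))
      by (rewrite scal_opp_one; exact (opp_minus g f)).
    eapply Rle_trans; [apply op_norm_scal|].
    change (Cmod (Copp 1) * op_norm (minus g f) <= op_norm (minus g f)).
    rewrite Cmod_opp, Cmod_1; lra.
  - intros f g h e1 e2 H1 H2.
    rewrite (minus_trans g h f), Rplus_comm.
    eapply Rle_lt_trans; [apply op_norm_triangle|]; lra.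
Defined.

Canonical bounded_op_UniformSpace :=
  UniformSpace.Pack (bounded_op X Y) bounded_op_UniformSpace_mixin
    (bounded_op X Y).

Canonical bounded_op_NormedModuleAux :=
  NormedModuleAux.Pack C_AbsRing (bounded_op X Y)
    (NormedModuleAux.Class C_AbsRing _
      (ModuleSpace.class C_Ring bounded_op_ModuleSpace)
      bounded_op_UniformSpace_mixin) (bounded_op X Y).

Definition bounded_op_NormedModule_mixin :
  NormedModule.mixin_of C_AbsRing bounded_op_NormedModuleAux.
Proof.
  apply (NormedModule.Mixin C_AbsRing bounded_op_NormedModuleAux op_norm 1).
  - apply op_norm_triangle.
  - apply op_norm_scal.
  - intros f g e H; exact H.
  - intros f g e H; rewrite Rmult_1_l; exact H.
  - apply op_norm_eq0.
Defined.

Canonical bounded_op_NormedModule :=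
  NormedModule.Pack C_AbsRing (bounded_op X Y)
    (NormedModule.Class _ _ _ bounded_op_NormedModule_mixin) (bounded_op X Y).

End BoundedOp.

Definition op_id {X : NormedModule C_AbsRing} : bounded_op X X :=
  Bounded_op (fun x => x) is_linear_id.

Definition op_comp {X Y Z : NormedModule C_AbsRing}
    (g : bounded_op Y Z) (f : bounded_op X Y) : bounded_op X Z :=
  Bounded_op (fun x => g (f x))
    (is_linear_comp f g (op_is_linear f) (op_is_linear g)).

Declare Scope op_scope.
Delimit Scope op_scope with op.
Notation "g ∘ f" := (op_comp g f) (at level 40, left associativity) : op_scope.
Local Open Scope op_scope.

Section Pencil.

Context {X Y : NormedModule C_AbsRing}.

Definition op_range (A : bounded_op X Y) (y : Y) : Prop := exists x, A x = y.

Definition op_null (A : bounded_op X Y) (x : X) : Prop := A x = zero.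

Definition is_inverse (A : bounded_op X Y) (B : bounded_op Y X) : Prop :=
  A ∘ B = op_id /\ B ∘ A = op_id.

Definition generalized_inverse (T : bounded_op X Y) (Tp : bounded_op Y X) :
    Prop :=
  T ∘ Tp ∘ T = T /\ Tp ∘ T ∘ Tp = Tp.

Definition pencil (T S : bounded_op X Y) (lam : C) : bounded_op X Y :=
  minus T (scal lam S).

(** A function on [U] is represented by a total function on [C], of which only
    the values on [U] are constrained. *)
Definition generalized_resolvent (U : C -> Prop) (T S : bounded_op X Y)
    (G : C -> bounded_op Y X) : Prop :=
  (forall lam, U lam -> pencil T S lam ∘ G lam ∘ pencil T S lam = pencil T S lam)
  /\ (forall lam, U lam -> G lam ∘ pencil T S lam ∘ G lam = G lam)
  /\ (forall lam mu, U lam -> U mu ->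
        minus (G lam) (G mu) = scal (lam - mu)%C (G lam ∘ S ∘ G mu)).

End Pencil.

Definition neighborhood_of_0 (U : C -> Prop) : Prop := open U /\ U (RtoC 0).

(** Around each point of [U], [G] is the sum of a power series with coefficients
    in [V]; for [V = B(Y, X)] convergence is in operator norm. *)
Definition analytic_on {V : NormedModule C_AbsRing} (U : C -> Prop)
    (G : C -> V) : Prop :=
  forall lam0, U lam0 -> exists a : nat -> V,
    locally lam0 (fun lam => is_pseries a (lam - lam0)%C (G lam)).

Definition analytic_generalized_resolvent {X Y : NormedModule C_AbsRing}
    (U : C -> Prop) (T S : bounded_op X Y) (G : C -> bounded_op Y X) : Prop :=
  generalized_resolvent U T S G /\ analytic_on U G.

Definition has_analytic_generalized_resolvent_near_0
    {X Y : NormedModule C_AbsRing} (T S : bounded_op X Y) : Prop :=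
  exists U, neighborhood_of_0 U /\
    exists G, analytic_generalized_resolvent U T S G.

Definition range_null_trivial {X Y : NormedModule C_AbsRing}
    (A : bounded_op X Y) (Tp : bounded_op Y X) : Prop :=
  forall y, op_range A y /\ op_null Tp y <-> y = zero.

(* Main.v *)
Require Import Defs.
From Stdlib Require Import Reals Lra ClassicalEpsilon.
From Coquelicot Require Import Coquelicot.
Local Open Scope op_scope.

(** (1) If [G] is a generalized resolvent and [y = (T - lam S) x] is killed by
    [T+], then [z = G(lam) y] lies in the range of [G(0)] by the resolvent
    identity, so [z = G(0) T z = G(0) T T+ T z = lam G(0) T T+ S z], which forces
    [z = 0] for small [lam]; hence [y = (T - lam S) z = 0].

    (2) With [J = (I - lam S T+)^-1] one has
    [(T - lam S) T+ J y = y - w] where [w = (I - T T+) J y] is killed by [T+],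
    and [J] is the identity on [N(T+)]. This gives the second identity for
    [G = T+ J] unconditionally; for [y] in the range of [T - lam S], [w] lies
    in the range too, and the hypothesis kills it. Analyticity is automatic:
    iterating the resolvent identity expands [G] around [lam0] as the series
    of [(lam - lam0)^n G(lam0) (S G(lam0))^n]. *)

(** * Difference calculus in abelian groups *)

Lemma minus_minus_cancel_l {V : AbelianGroup} (u v t : V) :
  minus (minus u v) (minus u t) = minus t v.
Proof.
  unfold minus at 1; rewrite opp_minus, plus_comm; symmetry; apply minus_trans.
Qed.

Lemma minus_minus_r {V : AbelianGroup} (u v : V) : minus u (minus u v) = v.
Proof.
  rewrite <- (minus_zero_r u) at 1; rewrite minus_minus_cancel_l.
  apply minus_zero_r.
Qed.

Lemma minus_plus_cancel_l {V : AbelianGroup} (u v : V) : minus (plus u v) u = v.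
Proof.
  unfold minus; rewrite (plus_comm u), <- plus_assoc.
  etransitivity; [apply f_equal, plus_opp_r|apply plus_zero_r].
Qed.

Lemma plus_minus_cancel {V : AbelianGroup} (u v : V) : plus v (minus u v) = u.
Proof.
  unfold minus; rewrite plus_comm, <- plus_assoc.
  etransitivity; [apply f_equal, plus_opp_l|apply plus_zero_r].
Qed.

Lemma eq_of_minus_zero {V : AbelianGroup} (u v : V) : minus u v = zero -> u = v.
Proof. intros H; rewrite <- (plus_minus_cancel u v), H; apply plus_zero_r. Qed.

Lemma minus_eq_swap {V : AbelianGroup} (u v a b : V) :
  minus u a = minus v b -> minus u v = minus a b.
Proof.
  intros E; rewrite (minus_trans a u v), E, plus_comm.
  symmetry; apply minus_trans.
Qed.

Lemma minus_plus_plus {V : AbelianGroup} (u v a b : V) :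
  minus (plus u v) (plus a b) = plus (minus u a) (minus v b).
Proof.
  unfold minus; rewrite opp_plus, <- !plus_assoc; f_equal.
  rewrite !plus_assoc; f_equal; apply plus_comm.
Qed.

(** * Contractions and smallness conditions on the parameter *)

Lemma contraction_fixed_zero {V : NormedModule C_AbsRing} (q : R) (z : V) :
  q < 1 -> norm z <= q * norm z -> z = zero.
Proof.
  intros Hq H; apply norm_eq_zero.
  generalize (norm_ge_0 z); intros; nra.
Qed.

(** Smallness is stated as a product, not as a disc of radius [1 / c], so that [c = 0] is no special
    case. *)
Lemma open_Cmod_minus_lt (lam0 : C) (c : R) :
  open (fun lam : C => Cmod (lam - lam0)%C * c < 1).
Proof.
  apply (open_comp (fun lam : C_UniformSpace => Cmod (lam - lam0)%C * c)
           (fun r => r < 1)); [|apply open_lt].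
  intros lam _.
  apply (continuous_comp (fun lam : C_UniformSpace => Cmod (lam - lam0)%C)
           (fun r => r * c)).
  - apply (continuous_comp (fun lam : C_UniformSpace => (lam - lam0)%C)
             (@norm C_AbsRing C_NormedModule)).
    + apply (continuous_minus (V := C_NormedModule)
               (fun lam : C_UniformSpace => lam) (fun _ => lam0)).
      * apply continuous_id.
      * apply continuous_const.
    + apply (filterlim_norm (V := C_NormedModule)).
  - apply (continuous_scal_l (K := R_AbsRing) (V := R_NormedModule)
             (fun r : R => r) c).
    apply continuous_id.
Qed.

Lemma neighborhood_of_0_Cmod_lt (U : C -> Prop) (c : R) :
  neighborhood_of_0 U ->
  neighborhood_of_0 (fun lam => U lam /\ Cmod lam * c < 1).
Proof.
  intros [HU U0]; split.
  - apply open_and; [exact HU|].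
    apply open_ext with (2 := open_Cmod_minus_lt 0 c); intros lam.
    assert (E : forall z : C, (z - 0)%C = z) by (intros; ring).
    rewrite E; tauto.
  - split; [exact U0|]; rewrite Cmod_0; lra.
Qed.

(** * Pointwise rules for bounded operators and the pencil *)

Section Operators.

Context {X Y Z : NormedModule C_AbsRing}.

Lemma op_app_minus (f : bounded_op X Y) x y : f (minus x y) = minus (f x) (f y).
Proof. apply linear_minus, op_is_linear. Qed.

Lemma op_app_plus (f : bounded_op X Y) x y : f (plus x y) = plus (f x) (f y).
Proof. apply linear_plus, op_is_linear. Qed.

Lemma op_app_scal (f : bounded_op X Y) (k : C) x : f (scal k x) = scal k (f x).
Proof. apply (linear_scal f (op_is_linear f)). Qed.

Lemma op_app_zero (f : bounded_op X Y) : f zero = zero.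
Proof. apply linear_zero, op_is_linear. Qed.

Lemma op_eq_app (f g : bounded_op X Y) x : f = g -> f x = g x.
Proof. now intros ->. Qed.

Lemma op_norm_comp (g : bounded_op Y Z) (f : bounded_op X Y) :
  op_norm (g ∘ f) <= op_norm g * op_norm f.
Proof.
  apply op_norm_le.
  - apply Rmult_le_pos; apply op_norm_ge0.
  - intros x; eapply Rle_trans; [apply (op_norm_apply g (f x))|].
    rewrite Rmult_assoc; apply Rmult_le_compat_l; [apply op_norm_ge0|].
    apply op_norm_apply.
Qed.

Lemma pencil_app (T S : bounded_op X Y) (lam : C) x :
  pencil T S lam x = minus (T x) (scal lam (S x)).
Proof. reflexivity. Qed.

Lemma pencil_0 (T S : bounded_op X Y) x : pencil T S 0 x = T x.
Proof.
  rewrite pencil_app.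
  transitivity (minus (T x) zero); [apply f_equal|exact (minus_zero_r (T x))].
  apply (scal_zero_l (V := NormedModule.ModuleSpace C_AbsRing Y)).
Qed.

End Operators.

(** * Operator powers and Neumann inversion *)

Fixpoint op_pow {X : NormedModule C_AbsRing} (A : bounded_op X X) (n : nat) :
    bounded_op X X :=
  match n with
  | O => op_id
  | Datatypes.S m => A ∘ op_pow A m
  end.

Lemma op_norm_pow {X : NormedModule C_AbsRing} (A : bounded_op X X) n :
  op_norm (op_pow A n) <= op_norm A ^ n.
Proof.
  induction n as [|n IH]; simpl.
  (* Only an inequality is available at exponent 0: the identity of a trivial space has norm 0. *)
  - apply op_norm_le; [lra|]; intros x; simpl; lra.
  - eapply Rle_trans; [apply op_norm_comp|].
    apply Rmult_le_compat_l; [apply op_norm_ge0|exact IH].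
Qed.

(** The solution is the sum [z] of the [B^n y], which converges by completeness and comparison with
    a geometric series. The series without its first term sums both to [z - y] and to [B z]. *)
Lemma neumann_solution {Y : CompleteNormedModule C_AbsRing} (B : bounded_op Y Y) y :
  op_norm B < 1 -> exists z : Y, minus z (B z) = y.
Proof.
  intros HB.
  assert (Hs : ex_series (fun n => op_pow B n y)).
  { apply (ex_series_le (fun n => op_pow B n y)
             (fun n => op_norm B ^ n * norm y)).
    - intros n; eapply Rle_trans; [apply op_norm_apply|].
      apply Rmult_le_compat_r; [apply norm_ge_0|apply op_norm_pow].
    - apply (ex_series_scal_r (norm y)), ex_series_geom.
      rewrite Rabs_pos_eq; [exact HB|apply op_norm_ge0]. }
  destruct Hs as [z Hz]; exists z.
  assert (H1 : is_series (fun n => op_pow B (Datatypes.S n) y) (minus z y)).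
  { assert (E : plus (minus z y) y = z)
      by (rewrite plus_comm; exact (plus_minus_cancel z y)).
    apply (is_series_incr_1 (fun n => op_pow B n y)).
    exact (eq_ind_r (is_series (fun n => op_pow B n y)) Hz E). }
  assert (H2 : is_series (fun n => op_pow B (Datatypes.S n) y) (B z)).
  { unfold is_series.
    apply filterlim_ext with (fun n => B (sum_n (fun n => op_pow B n y) n)).
    - intros n; induction n as [|n IH].
      + now rewrite !sum_O.
      + rewrite !sum_Sn, op_app_plus, IH; reflexivity.
    - eapply filterlim_comp; [exact Hz|].
      apply linear_cont, op_is_linear. }
  rewrite <- (filterlim_locally_unique _ _ _ H1 H2).
  apply minus_minus_r.
Qed.

(** Since [I - B] is injective, solutions are unique; the chosen solution map is therefore linear
    and a two-sided inverse. *)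
Lemma contraction_inverse {Y : NormedModule C_AbsRing} (B : bounded_op Y Y) :
  op_norm B < 1 -> (forall y : Y, exists z : Y, minus z (B z) = y) ->
  exists J : bounded_op Y Y, is_inverse (minus op_id B) J.
Proof.
  intros HB Hsol.
  assert (Hinj : forall u v : Y, minus u (B u) = minus v (B v) -> u = v).
  { intros u v E; apply eq_of_minus_zero.
    apply (contraction_fixed_zero (V := Y) (op_norm B)); [exact HB|].
    replace (norm (minus u v)) with (norm (B (minus u v))) at 1;
      [apply op_norm_apply|].
    f_equal; rewrite op_app_minus; symmetry.
    exact (minus_eq_swap u v (B u) (B v) E). }
  pose (J := fun y => proj1_sig (constructive_indefinite_description _
                                   (Hsol y))).
  assert (HJ : forall y, minus (J y) (B (J y)) = y).
  { intros y; exact (proj2_sig (constructive_indefinite_description _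
                                   (Hsol y))). }
  assert (LJ : is_linear J).
  { split.
    - intros u v; apply Hinj; rewrite op_app_plus, HJ.
      rewrite <- (HJ u) at 1; rewrite <- (HJ v) at 1; symmetry.
      exact (minus_plus_plus (J u) (J v) (B (J u)) (B (J v))).
    - intros k u; apply Hinj; rewrite op_app_scal, HJ.
      rewrite <- (HJ u) at 1.
      apply (scal_minus_distr_l (V := NormedModule.ModuleSpace C_AbsRing Y)).
    (* From [J y = y + B (J y)], the norm of [J y] times [1 - op_norm B] is at most the norm of
       [y]. *)
    - exists (/ (1 - op_norm B)); split; [apply Rinv_0_lt_compat; lra|].
      intros y; rewrite Rmult_comm; apply Rle_div_r; [lra|].
      assert (H : norm (J y) <= norm y + norm (B (J y))).
      { rewrite <- (plus_minus_cancel (J y) (B (J y))) at 1.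
        rewrite HJ, Rplus_comm; apply norm_triangle. }
      generalize (op_norm_apply B (J y)); lra. }
  exists (Bounded_op J LJ); split; apply bounded_op_eq; intros y.
  - exact (HJ y).
  - apply Hinj; exact (HJ (minus y (B y))).
Qed.

Lemma neumann_inverse {Y : CompleteNormedModule C_AbsRing} (B : bounded_op Y Y) :
  op_norm B < 1 -> exists J : bounded_op Y Y, is_inverse (minus op_id B) J.
Proof.
  intros HB; apply contraction_inverse; [exact HB|].
  intros y; now apply neumann_solution.
Qed.

(** * Generalized resolvents: expansion, necessity and construction *)

Section Resolvent.

Context {X Y : NormedModule C_AbsRing}.

(** Repeated substitution of [G1 = G0 + t G1 S G0] for the leftmost factor of the remainder; the
    identity is exact for every [n]. *)
Lemma resolvent_expansion (S : bounded_op X Y) (G0 G1 : bounded_op Y X) (t : C) n :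
  minus G1 G0 = scal t (G1 ∘ S ∘ G0) ->
  G1 = plus (sum_n (fun k => scal (pow_n t k) (G0 ∘ op_pow (S ∘ G0) k)) n)
            (scal (pow_n t (Datatypes.S n)) (G1 ∘ op_pow (S ∘ G0) (Datatypes.S n))).
Proof.
  intros E.
  assert (E' : forall v, G1 v = plus (G0 v) (scal t (G1 (S (G0 v))))).
  { intros v; rewrite <- (plus_minus_cancel (G1 v) (G0 v)); f_equal.
    exact (op_eq_app _ _ v E). }
  assert (Estep : forall k, scal (pow_n t k) (G1 ∘ op_pow (S ∘ G0) k) =
    plus (scal (pow_n t k) (G0 ∘ op_pow (S ∘ G0) k))
         (scal (pow_n t (Datatypes.S k)) (G1 ∘ op_pow (S ∘ G0) (Datatypes.S k)))).
  { intros k; apply bounded_op_eq; intros y.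
    change (scal (pow_n t k) (G1 (op_pow (S ∘ G0) k y)) =
      plus (scal (pow_n t k) (G0 (op_pow (S ∘ G0) k y)))
        (scal (mult t (pow_n t k)) (G1 (S (G0 (op_pow (S ∘ G0) k y)))))).
    rewrite E' at 1.
    rewrite (scal_distr_l (V := NormedModule.ModuleSpace C_AbsRing X)).
    f_equal.
    rewrite (scal_assoc (V := NormedModule.ModuleSpace C_AbsRing X)).
    f_equal; apply Cmult_comm. }
  induction n as [|n IH].
  - rewrite sum_O, <- Estep; apply bounded_op_eq; intros y.
    symmetry; apply (scal_one (V := NormedModule.ModuleSpace C_AbsRing X)).
  - rewrite sum_Sn, <- plus_assoc, <- Estep; exact IH.
Qed.

(** The remainder of the finite expansion is bounded by a geometric sequence of ratio [q]. *)
Lemma resolvent_pseries (S : bounded_op X Y) (G0 G1 : bounded_op Y X) (t : C) :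
  minus G1 G0 = scal t (G1 ∘ S ∘ G0) -> Cmod t * op_norm (S ∘ G0) < 1 ->
  is_pseries (fun k => G0 ∘ op_pow (S ∘ G0) k) t G1.
Proof.
  intros E Ht; set (q := Cmod t * op_norm (S ∘ G0)) in Ht.
  assert (q0 : 0 <= q).
  { apply Rmult_le_pos; [apply Cmod_ge_0|apply op_norm_ge0]. }
  assert (Hpow : forall n, Cmod (pow_n (K := C_Ring) t n) = Cmod t ^ n).
  { induction n as [|n IH]; simpl; [apply Cmod_1|].
    rewrite <- IH; apply Cmod_mult. }
  (* The exponent is [n + 1] because [sum_n] up to [n] already contains the terms 0 to [n]. *)
  assert (Hlim : is_lim_seq (fun n => op_norm G1 * q ^ Datatypes.S n) 0).
  { replace 0 with (op_norm G1 * 0) by ring.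
    apply (is_lim_seq_scal_l (fun n => q ^ Datatypes.S n) _ (Finite 0)).
    apply (is_lim_seq_incr_1 (fun n => q ^ n)), is_lim_seq_geom.
    now rewrite Rabs_pos_eq. }
  unfold is_pseries, is_series; apply filterlim_locally; intros eps.
  apply is_lim_seq_spec in Hlim; destruct (Hlim eps) as [N HN].
  exists N; intros n Hn; apply ball_sym.
  specialize (HN n Hn); rewrite Rminus_0_r, Rabs_pos_eq in HN.
  2: { apply Rmult_le_pos; [apply op_norm_ge0|now apply pow_le]. }
  eapply Rle_lt_trans; [|exact HN].
  generalize (resolvent_expansion S G0 G1 t n E).
  set (s := sum_n _ n); set (r := scal _ _); intros Er.
  assert (D : minus G1 s = r) by (rewrite Er; exact (minus_plus_cancel_l s r)).
  change (op_norm (minus G1 s) <= op_norm G1 * q ^ Datatypes.S n).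
  rewrite D; unfold r.
  eapply Rle_trans; [apply op_norm_scal|].
  rewrite Hpow; unfold q; rewrite Rpow_mult_distr.
  replace (op_norm G1 * (Cmod t ^ Datatypes.S n * op_norm (S ∘ G0) ^ Datatypes.S n))
    with (Cmod t ^ Datatypes.S n * (op_norm G1 * op_norm (S ∘ G0) ^ Datatypes.S n))
    by ring.
  apply Rmult_le_compat_l; [apply pow_le, Cmod_ge_0|].
  eapply Rle_trans; [apply op_norm_comp|].
  apply Rmult_le_compat_l; [apply op_norm_ge0|apply op_norm_pow].
Qed.

Lemma generalized_resolvent_analytic (U : C -> Prop) (T S : bounded_op X Y) G :
  open U -> generalized_resolvent U T S G -> analytic_on U G.
Proof.
  intros HU (_ & _ & Hres) lam0 H0.
  exists (fun k => G lam0 ∘ op_pow (S ∘ G lam0) k).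
  apply (filter_imp
    (fun lam => U lam /\ Cmod (lam - lam0)%C * op_norm (S ∘ G lam0) < 1)).
  - intros lam [H Hs]; apply resolvent_pseries; [now apply Hres|exact Hs].
  - apply (open_and U); [exact HU|apply open_Cmod_minus_lt|].
    split; [exact H0|].
    replace (lam0 - lam0)%C with (RtoC 0) by ring; rewrite Cmod_0; lra.
Qed.

(** The operator in the smallness condition does not depend on [lam], so one disc serves all
    parameters. *)
Lemma generalized_resolvent_range_null (U : C -> Prop) (T S : bounded_op X Y)
    (G : C -> bounded_op Y X) (Tp : bounded_op Y X) (lam : C) :
  generalized_resolvent U T S G -> generalized_inverse T Tp -> U (RtoC 0) ->
  U lam -> Cmod lam * op_norm (G 0 ∘ T ∘ Tp ∘ S) < 1 ->
  range_null_trivial (pencil T S lam) Tp.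
Proof.
  intros (H1 & H2 & H3) [HT _] U0 Ul Hs y; split.
  2: { intros ->; split; [exists zero|]; apply op_app_zero. }
  intros [[x Hx] Hy].
  assert (Pz : pencil T S lam (G lam y) = y).
  { rewrite <- Hx; exact (op_eq_app _ _ x (H1 lam Ul)). }
  set (z := G lam y) in *.
  (* The resolvent identity between 0 and [lam], applied to [y] and solved for [z]. *)
  assert (Hw : z = G 0 (minus y (scal (0 - lam)%C (S z)))).
  { rewrite op_app_minus, op_app_scal.
    transitivity (minus (G 0 y) (minus (G 0 y) z)).
    - symmetry; exact (minus_minus_r (G 0 y) z).
    - f_equal; exact (op_eq_app _ _ y (H3 0 lam U0 Ul)). }
  assert (GTz : G 0 (T z) = z).
  { rewrite Hw, <- (pencil_0 T S); exact (op_eq_app _ _ _ (H2 0 U0)). }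
  (* This is [Tp y = 0] with [y] written as [T z - lam S z]. *)
  assert (TTz : Tp (T z) = scal lam (Tp (S z))).
  { apply (eq_of_minus_zero (V := NormedModule.AbelianGroup C_AbsRing X)).
    rewrite <- op_app_scal, <- op_app_minus, <- pencil_app, Pz; exact Hy. }
  assert (Ez : z = scal lam ((G 0 ∘ T ∘ Tp ∘ S) z)).
  { simpl; rewrite <- (op_app_scal (G 0)), <- (op_app_scal T), <- TTz.
    rewrite (op_eq_app _ _ z HT : T (Tp (T z)) = T z); now symmetry. }
  rewrite <- Pz, (contraction_fixed_zero _ z Hs); [apply op_app_zero|].
  rewrite Ez at 1; eapply Rle_trans; [apply (norm_scal (V := X))|].
  rewrite Rmult_assoc; apply Rmult_le_compat_l; [apply Cmod_ge_0|].
  apply op_norm_apply.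
Qed.

Lemma generalized_resolvent_of_inverse (V : C -> Prop) (T S : bounded_op X Y)
    (Tp : bounded_op Y X) (J : C -> bounded_op Y Y) :
  generalized_inverse T Tp ->
  (forall lam, V lam -> range_null_trivial (pencil T S lam) Tp) ->
  (forall lam, V lam -> is_inverse (minus op_id (scal lam (S ∘ Tp))) (J lam)) ->
  generalized_resolvent V T S (fun lam => Tp ∘ J lam).
Proof.
  intros [HT HTp] Htriv HJ.
  assert (Ja : forall lam, V lam -> forall y,
    minus (J lam y) (scal lam (S (Tp (J lam y)))) = y).
  { intros lam Hl y; exact (op_eq_app _ _ y (proj1 (HJ lam Hl))). }
  assert (Jb : forall lam, V lam -> forall y : Y,
    J lam (minus y (scal lam (S (Tp y)))) = y).
  { intros lam Hl y; exact (op_eq_app _ _ y (proj2 (HJ lam Hl))). }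
  (* [I - lam S Tp] fixes the null space of [Tp] pointwise, hence so does its inverse. *)
  assert (JN : forall lam, V lam -> forall y, Tp y = zero -> J lam y = y).
  { intros lam Hl y Hy; rewrite <- (Jb lam Hl y) at 2; f_equal.
    rewrite Hy, op_app_zero.
    rewrite (scal_zero_r (V := NormedModule.ModuleSpace C_AbsRing Y)).
    symmetry; exact (minus_zero_r y). }
  (* The defect by which [Tp J] fails to be a right inverse of the pencil. *)
  set (w := fun lam (y : Y) => minus (J lam y) (T (Tp (J lam y))) : Y).
  assert (Tw : forall lam y, Tp (w lam y) = zero).
  { intros lam y; unfold w; rewrite op_app_minus.
    rewrite (op_eq_app _ _ (J lam y) HTp
               : Tp (T (Tp (J lam y))) = Tp (J lam y)).
    exact (minus_eq_zero (Tp (J lam y))). }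
  assert (PG : forall lam, V lam -> forall y,
    pencil T S lam (Tp (J lam y)) = minus y (w lam y)).
  { intros lam Hl y; rewrite pencil_app; symmetry.
    transitivity (minus (minus (J lam y) (scal lam (S (Tp (J lam y)))))
                        (w lam y)); [now rewrite Ja|].
    exact (minus_minus_cancel_l (J lam y) _ (T (Tp (J lam y)))). }
  split; [|split].
  - intros lam Hl; apply bounded_op_eq; intros x.
    change (pencil T S lam (Tp (J lam (pencil T S lam x))) = pencil T S lam x).
    rewrite PG by exact Hl.
    replace (w lam (pencil T S lam x)) with (zero : Y);
      [exact (minus_zero_r (pencil T S lam x))|].
    symmetry; apply (Htriv lam Hl); split; [|apply Tw].
    (* With [P] the pencil and [G = Tp J], the defect at [P x] is
       [P x - P G P x = P (x - G P x)]. *)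
    exists (minus x (Tp (J lam (pencil T S lam x)))).
    rewrite op_app_minus, PG by exact Hl.
    exact (minus_minus_r (pencil T S lam x) _).
  - intros lam Hl; apply bounded_op_eq; intros y.
    change (Tp (J lam (pencil T S lam (Tp (J lam y)))) = Tp (J lam y)).
    rewrite PG by exact Hl.
    (* [J] fixes the defect and [Tp] then kills it. *)
    rewrite !op_app_minus, (JN lam Hl _ (Tw lam y)), Tw.
    exact (minus_zero_r (Tp (J lam y))).
  - intros lam mu Hl Hm; apply bounded_op_eq; intros y.
    change (minus (Tp (J lam y)) (Tp (J mu y)) =
            scal (lam - mu)%C (Tp (J lam (S (Tp (J mu y)))))).
    set (u := J mu y); set (a := S (Tp u)).
    (* The equation [y = u - mu a] is rewritten around [lam]; applying [J lam] turns the first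
       summand into [u], and [Tp] then gives the resolvent identity. *)
    assert (E : y = plus (minus u (scal lam a)) (scal (lam - mu)%C a)).
    { rewrite <- (Ja mu Hm y) at 1.
      etransitivity; [exact (minus_trans (scal lam a) u (scal mu a))|].
      apply f_equal; symmetry.
      apply (scal_minus_distr_r (V := NormedModule.ModuleSpace C_AbsRing Y)
               (lam : C_Ring) mu a). }
    assert (EJ : J lam y = plus u (scal (lam - mu)%C (J lam a))).
    { rewrite <- (Jb lam Hl u), <- (op_app_scal (J lam)).
      etransitivity; [exact (f_equal (J lam) E)|].
      exact (op_app_plus (J lam) _ _). }
    rewrite EJ, <- (op_app_scal Tp).
    etransitivity; [exact (f_equal (fun v => minus v (Tp u)) (op_app_plus Tp _ _))|].
    exact (minus_plus_cancel_l (Tp u) _).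
Qed.

End Resolvent.

Theorem theorem2p1 (X Y : CompleteNormedModule C_AbsRing) (T S : bounded_op X Y) :
  (has_analytic_generalized_resolvent_near_0 T S ->
   forall Tp : bounded_op Y X, generalized_inverse T Tp ->
   exists U0 : C -> Prop, neighborhood_of_0 U0 /\
     forall lam, U0 lam -> range_null_trivial (pencil T S lam) Tp)
  /\
  (forall Tp : bounded_op Y X, generalized_inverse T Tp ->
   (exists U : C -> Prop, neighborhood_of_0 U /\
     forall lam, U lam -> range_null_trivial (pencil T S lam) Tp) ->
   has_analytic_generalized_resolvent_near_0 T S
   /\
   exists (V : C -> Prop) (J : C -> bounded_op Y Y),
     neighborhood_of_0 V /\
     (forall lam, V lam -> is_inverse (minus op_id (scal lam (S ∘ Tp))) (J lam)) /\
     generalized_resolvent V T S (fun lam => Tp ∘ J lam)).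
Proof.
  split.
  - intros (U & HU & G & HG & _) Tp HTp.
    exists (fun lam => U lam /\ Cmod lam * op_norm (G 0 ∘ T ∘ Tp ∘ S) < 1).
    split; [now apply neighborhood_of_0_Cmod_lt|].
    intros lam [Ul Hs].
    now apply (generalized_resolvent_range_null U T S G); [| |apply HU| |].
  - intros Tp HTp (U & HU & Htriv).
    (* The added bound makes [lam S Tp] a strict contraction, so that the Neumann series applies. *)
    pose (V := fun lam => U lam /\ Cmod lam * op_norm (S ∘ Tp) < 1).
    assert (HV : neighborhood_of_0 V) by now apply neighborhood_of_0_Cmod_lt.
    assert (HJ : exists J : C -> bounded_op Y Y, forall lam, V lam ->
      is_inverse (minus op_id (scal lam (S ∘ Tp))) (J lam)).
    (* One inverse is chosen for each [lam]; [op_id] only shows that the type is inhabited, and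
       values outside [V] are left unspecified. *)
    { exists (fun lam => epsilon (inhabits op_id)
                (is_inverse (minus op_id (scal lam (S ∘ Tp))))).
      intros lam [_ Hs]; apply epsilon_spec, neumann_inverse.
      eapply Rle_lt_trans; [apply op_norm_scal|exact Hs]. }
    destruct HJ as [J HJ].
    assert (HG : generalized_resolvent V T S (fun lam => Tp ∘ J lam)).
    { apply generalized_resolvent_of_inverse; trivial.
      intros lam [Ul _]; now apply Htriv. }
    split; [|now exists V, J].
    exists V; split; [exact HV|]; exists (fun lam => Tp ∘ J lam).
    split; [exact HG|]; apply generalized_resolvent_analytic with T S; trivial.
    apply HV.
Qed.
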